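(* In the Sedenions, there are exactly $42$ Assessors, and exactly $168$ primitive unit zero-divisors; the latter are precisely the $4\cdot 42$ elements $\frac{1}{\sqrt2}(\pm i_A\pm i_B)$ with $(A,B)$ an Assessor. Moreover, whenever two Assessors $(A,B)$ and $(C,D)$ are Co-Assessors, each of the two diagonals $i_A+i_B$, $i_A-i_B$ of the first has product zero with exactly one of the two diagonals $i_C+i_D$, $i_C-i_D$ of the second.
   Context: The Sedenions are the 16-dimensional real (non-associative, distributive) algebra with basis $1,i_1,\dots,i_{15}$, where $1$ is the unit, $i_n^2=-1$, $i_mi_n=-i_ni_m$ for $m\ne n$, and for each triplet $(a,b,c)$ in the following list $i_ai_b=i_c$, $i_bi_c=i_a$, $i_ci_a=i_b$. O-trips: (1,2,3),(1,4,5),(1,7,6),(2,4,6),(2,5,7),(3,4,7),(3,6,5). S-trips: (1,8,9),(1,11,10),(1,13,12),(1,14,15),(2,8,10),(2,9,11),(2,14,12),(2,15,13),(3,8,11),(3,10,9),(3,15,12),(3,13,14),(4,8,12),(4,9,13),(4,10,14),(4,11,15),(5,8,13),(5,12,9),(5,10,15),(5,14,11),(6,8,14),(6,15,9),(6,12,10),(6,11,13),(7,8,15),(7,9,14),(7,13,10),(7,12,11). Thus $i_mi_n=\pm i_{m\oplus n}$, where $\oplus$ is bitwise XOR. A primitive unit zero-divisor is an element of the form $\frac{1}{\sqrt2}(\pm i_A\pm i_B)$ with $1\le A,B\le 15$, $A\neq B$, which is a zero-divisor, i.e. whose product with some nonzero Sedenion is $0$. Two (unordered) pairs $(A,B)$,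 $(C,D)$ of distinct indices in $\{1,\dots,15\}$ are Co-Assessors if $(i_A+s\,i_B)(i_C+t\,i_D)=0$ for some signs $s,t\in\{+1,-1\}$. A pair $(A,B)$ is an Assessor if it is a Co-Assessor of some pair. *)

(* Defs.v *)
From mathcomp Require Import all_boot all_order all_algebra.
From mathcomp Require Import classical_sets cardinality reals.
Set Implicit Arguments.
Unset Strict Implicit.
Unset Printing Implicit Defensive.
Import Order.TTheory GRing.Theory Num.Theory.
Local Open Scope ring_scope.

Definition O_trips : seq (nat * nat * nat) :=
  [:: (1, 2, 3); (1, 4, 5); (1, 7, 6); (2, 4, 6); (2, 5, 7); (3, 4, 7);
      (3, 6, 5)]%N.

Definition S_trips : seq (nat * nat * nat) :=
  [:: (1, 8, 9); (1, 11, 10); (1, 13, 12); (1, 14, 15);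
      (2, 8, 10); (2, 9, 11); (2, 14, 12); (2, 15, 13);
      (3, 8, 11); (3, 10, 9); (3, 15, 12); (3, 13, 14);
      (4, 8, 12); (4, 9, 13); (4, 10, 14); (4, 11, 15);
      (5, 8, 13); (5, 12, 9); (5, 10, 15); (5, 14, 11);
      (6, 8, 14); (6, 15, 9); (6, 12, 10); (6, 11, 13);
      (7, 8, 15); (7, 9, 14); (7, 13, 10); (7, 12, 11)]%N.

Definition trips := O_trips ++ S_trips.

Definition cyclic_trip (a b c : nat) : bool :=
  [|| (a, b, c) \in trips, (b, c, a) \in trips | (c, a, b) \in trips].

(* The coefficient of i_c in the product i_m i_n, where i_0 is the unit 1.    *)
Definition sed_coef (m n c : nat) : int :=
  if m == 0%N then (n == c)%:R
  else if n == 0%N then (m == c)%:R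
  else if m == n then - (c == 0%N)%:R
  else (cyclic_trip m n c)%:R - (cyclic_trip n m c)%:R.

Definition sedenion (R : realType) := 'rV[R]_16.

(* sed_basis m is i_m for 1 <= m <= 15, and sed_basis 0 is the unit 1.        *)
Definition sed_basis {R : realType} (m : 'I_16) : sedenion R := delta_mx 0 m.

Definition sed_mul {R : realType} (x y : sedenion R) : sedenion R :=
  \row_(c < 16) \sum_(m < 16) \sum_(n < 16) (sed_coef m n c)%:~R * (x 0 m * y 0 n).

Lemma sed_mul_basis (R : realType) (m n : 'I_16) :
  sed_mul (sed_basis m) (sed_basis n)
  = \sum_(c < 16) (sed_coef m n c)%:~R *: sed_basis c :> sedenion R.
Proof.
apply/rowP => c; rewrite summxE mxE (bigD1 m) //= (bigD1 n) //=.
rewrite [X in _ + X]big1 => [|i /negPf nim]; last first.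
  by rewrite big1 // => j _; rewrite !mxE nim andbF mul0r mulr0.
rewrite big1 => [|j /negPf njn]; last by rewrite !mxE njn andbF !mulr0.
rewrite (bigD1 c) //= big1 => [|d ndc]; last first.
  by rewrite !mxE eq_sym (negPf ndc) andbF mulr0.
by rewrite !mxE !eqxx /= mulr1 !addr0.
Qed.

Lemma sed_mul_basisE (R : realType) (m n k : 'I_16) (z : int) :
  all (fun c => sed_coef m n c == z * (c == k)%:R) (iota 0 16) ->
  sed_mul (sed_basis m) (sed_basis n) = z%:~R *: sed_basis k :> sedenion R.
Proof.
move=> /allP H; rewrite sed_mul_basis (bigD1 k) //= big1 => [|c nck].
  have /H/eqP -> : (k : nat) \in iota 0 16 by rewrite mem_iota /= add0n.
  by rewrite eqxx mulr1 addr0.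
have /H/eqP -> : (c : nat) \in iota 0 16 by rewrite mem_iota /= add0n.
by rewrite val_eqE (negPf nck) mulr0 scale0r.
Qed.

Lemma all_iota16 (p : nat -> bool) (m : 'I_16) : all p (iota 0 16) -> p m.
Proof. by move=> /allP; apply; rewrite mem_iota /= add0n. Qed.

Lemma sed_1mul (R : realType) (n : 'I_16) :
  sed_mul (sed_basis ord0) (sed_basis n) = sed_basis n :> sedenion R.
Proof.
rewrite (@sed_mul_basisE R _ _ n 1) ?scale1r //.
by apply: (all_iota16 (p := fun n => all (fun c => sed_coef 0 n c == 1 * (c == n)%:R)
                                       (iota 0 16))).
Qed.

Lemma sed_mul1 (R : realType) (n : 'I_16) :
  sed_mul (sed_basis n) (sed_basis ord0) = sed_basis n :> sedenion R.
Proof.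
rewrite (@sed_mul_basisE R _ _ n 1) ?scale1r //.
by apply: (all_iota16 (p := fun n => all (fun c => sed_coef n 0 c == 1 * (c == n)%:R)
                                       (iota 0 16))).
Qed.

Lemma sed_mul_sqr (R : realType) (n : 'I_16) : n != ord0 ->
  sed_mul (sed_basis n) (sed_basis n) = - sed_basis ord0 :> sedenion R.
Proof.
move=> n0; rewrite (@sed_mul_basisE R _ _ ord0 (-1)) ?scaleN1r //.
move: n0; apply/implyP.
by apply: (all_iota16 (p := fun n => (n != 0%N) ==>
  all (fun c => sed_coef n n c == -1 * (c == 0%N)%:R) (iota 0 16))).
Qed.

Lemma sed_mul_trip (R : realType) (a b c : 'I_16) : cyclic_trip a b c ->
  sed_mul (sed_basis a) (sed_basis b) = sed_basis c :> sedenion R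
  /\ sed_mul (sed_basis b) (sed_basis a) = - sed_basis c :> sedenion R.
Proof.
move=> abc; suff /andP[H1 H2] :
    all (fun d => sed_coef a b d == 1 * (d == c)%:R) (iota 0 16) &&
    all (fun d => sed_coef b a d == -1 * (d == c)%:R) (iota 0 16).
  by rewrite (sed_mul_basisE R H1) (sed_mul_basisE R H2) scale1r scaleN1r.
move: abc; apply/implyP.
apply: (all_iota16 (p := fun c => cyclic_trip a b c ==>
  (all (fun d => sed_coef a b d == 1 * (d == c)%:R) (iota 0 16) &&
   all (fun d => sed_coef b a d == -1 * (d == c)%:R) (iota 0 16)))).
apply: (all_iota16 (p := fun b => all (fun c => cyclic_trip a b c ==>
  (all (fun d => sed_coef a b d == 1 * (d == c)%:R) (iota 0 16) &&
   all (fun d => sed_coef b a d == -1 * (d == c)%:R) (iota 0 16))) (iota 0 16))).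
apply: (all_iota16 (p := fun a => all (fun b => all (fun c => cyclic_trip a b c ==>
  (all (fun d => sed_coef a b d == 1 * (d == c)%:R) (iota 0 16) &&
   all (fun d => sed_coef b a d == -1 * (d == c)%:R) (iota 0 16))) (iota 0 16))
  (iota 0 16))).
by vm_compute.
Qed.

Lemma cyclic_trip_total :
  all (fun m => all (fun n => (m == n) ||
    has (fun c => cyclic_trip m n c || cyclic_trip n m c) (iota 1 15))
  (iota 1 15)) (iota 1 15).
Proof. by vm_compute. Qed.

Definition imag (A : 'I_16) : bool := A != ord0.

(* i_A + i_B for s = false, i_A - i_B for s = true.                           *)
Definition sed_diag {R : realType} (A B : 'I_16) (s : bool) : sedenion R :=
  sed_basis A + (-1) ^+ s *: sed_basis B.

Definition zero_divisor {R : realType} (x : sedenion R) : Prop :=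
  exists y : sedenion R, y != 0 /\ (sed_mul x y = 0 \/ sed_mul y x = 0).

Definition unit_pair {R : realType} (A B : 'I_16) (s t : bool) : sedenion R :=
  (Num.sqrt 2)^-1 *: ((-1) ^+ s *: sed_basis A + (-1) ^+ t *: sed_basis B).

Definition primitive_unit_zero_divisor {R : realType} (x : sedenion R) : Prop :=
  (exists (A B : 'I_16) (s t : bool),
     [/\ imag A, imag B, A != B & x = unit_pair A B s t])
  /\ zero_divisor x.

(* Unordered pairs (A, B) are the finite sets [set A; B] with A != B; the     *)
(* labelling is immaterial since i_B + s i_A = s (i_A + s i_B) for s = +-1.   *)
Definition co_assessors (R : realType) (P Q : {set 'I_16}) : Prop :=
  exists A B C D : 'I_16,
    [/\ [/\ imag A, imag B & A != B], [/\ imag C, imag D & C != D],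
        P = [set A; B]%SET, Q = [set C; D]%SET &
        exists s t : bool, sed_mul (sed_diag A B s) (sed_diag C D t) = 0
                           :> sedenion R].

Definition assessor (R : realType) (P : {set 'I_16}) : Prop :=
  exists Q : {set 'I_16}, co_assessors R P Q.

(* Main.v *)
(** The product of two basis elements is a signed basis element, the index
    being the bitwise XOR of the two indices and the sign a bit [sgn].  Hence,
    for distinct imaginary units, [(i_A + s i_B) (i_C + t i_D) = 0] means that
    the four terms cancel in pairs, i.e. that [A xor C = B xor D] and that the
    two pairs of signs disagree; as this depends on [s] and [t] only through
    their product, [t] is determined by [s].

    The pairs [(A, B)] with [0 < A < 8 < B] and [B <> A + 8] are assessors by
    inspection.  For every other pair the multiplications by [i_A] and by [i_B]
    anticommute, so that the multiplication by [x = i_A +- i_B] squares to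
    [-2] and [x] is not a zero-divisor.  The counts are then [7 * 6] and
    [7 * 6 * 2 * 2]. *)

Require Import Defs.
From mathcomp Require Import all_boot all_order all_algebra.
From mathcomp Require Import classical_sets cardinality reals.
Set Implicit Arguments.
Unset Strict Implicit.
Unset Printing Implicit Defensive.
Import Order.TTheory GRing.Theory Num.Theory.
Local Open Scope classical_set_scope.
Local Open Scope card_scope.
Local Open Scope ring_scope.

(** * Counting by enumeration, unordered pairs, and checks over all indices *)

Lemma inj_range_card (T : finType) (U : Type) (f : T -> U) :
  injective f -> range f #= `I_#|T|.
Proof.
move=> f_inj.
have -> : range f = range (f \o @enum_val T T).
  apply/seteqP; split=> _ [x _ <-]; last by exists (enum_val x).
  by exists (enum_rank x) => //=; rewrite enum_rankK.
rewrite (card_eql (inj_card_eq _)) 1?card_eq_sym ?card_II //.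
by move=> i j _ _ /= /f_inj /enum_val_inj.
Qed.

Lemma set2_inj (T : finType) (A B C D : T) : A != B ->
  [set A; B]%SET = [set C; D]%SET -> (A = C /\ B = D) \/ (A = D /\ B = C).
Proof.
move=> nAB eqS.
have : A \in [set C; D]%SET by rewrite -eqS set21.
have : B \in [set C; D]%SET by rewrite -eqS set22.
move: nAB => /[swap] /set2P[] -> /[swap] /set2P[] ->; rewrite ?eqxx //.
- by right.
- by left.
Qed.

(** Finite checks on indices are moved from ordinals to [nat], where [vm_compute] decides them. *)
Lemma all2_iota16 {p : nat -> nat -> bool} (m n : 'I_16) :
  all (fun a => all (p a) (iota 0 16)) (iota 0 16) -> p m n.
Proof. by move=> /(all_iota16 m) /(all_iota16 n). Qed.

Lemma all3_iota16 {p : nat -> nat -> nat -> bool} (m n k : 'I_16) :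
  all (fun a => all (fun b => all (p a b) (iota 0 16)) (iota 0 16))
    (iota 0 16) -> p m n k.
Proof. by move=> /(all2_iota16 m n) /(all_iota16 k). Qed.

(** * XOR of indices and signs of products of basis elements *)

Definition xor16 (m n : 'I_16) : 'I_16 := inord (Nat.lxor m n).

Lemma val_xor16 (m n : 'I_16) : xor16 m n = Nat.lxor m n :> nat.
Proof.
rewrite inordK //.
by apply: (all2_iota16 (p := fun m n => Nat.lxor m n < 16)%N); vm_compute.
Qed.

Lemma xor16A (m n k : 'I_16) : xor16 m (xor16 n k) = xor16 (xor16 m n) k.
Proof.
apply/val_inj/eqP; rewrite /= !val_xor16.
apply: (all3_iota16 (p := fun m n k =>
  Nat.lxor m (Nat.lxor n k) == Nat.lxor (Nat.lxor m n) k)).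
by vm_compute.
Qed.

Lemma xor16C (m n : 'I_16) : xor16 m n = xor16 n m.
Proof.
apply/val_inj/eqP; rewrite /= !val_xor16.
by apply: (all2_iota16 (p := fun m n => Nat.lxor m n == Nat.lxor n m));
  vm_compute.
Qed.

Lemma xor16K (m n : 'I_16) : xor16 m (xor16 m n) = n.
Proof.
apply/val_inj/eqP; rewrite /= !val_xor16.
by apply: (all2_iota16 (p := fun m n => Nat.lxor m (Nat.lxor m n) == n));
  vm_compute.
Qed.

Lemma xor16_inj (m : 'I_16) : injective (xor16 m).
Proof. exact: can_inj (xor16K m). Qed.

Lemma xor16CA (m n k : 'I_16) : xor16 m (xor16 n k) = xor16 n (xor16 m k).
Proof. by rewrite !xor16A [xor16 m n]xor16C. Qed.

(** Once the first pair of terms in a product of two diagonals shares an index, so does the second: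
    one index equation governs both cancellations. *)
Lemma xor16_swap (A B C D : 'I_16) :
  xor16 A C = xor16 B D -> xor16 A D = xor16 B C.
Proof. by move=> eqAC; rewrite -[D](xor16K B) -eqAC xor16CA xor16K. Qed.

(* [sgn m n] holds when [i_m i_n = - i_(m xor n)]. *)
Definition sgn (m n : nat) : bool :=
  [&& m != 0, n != 0 & (m == n) || cyclic_trip n m (Nat.lxor m n)]%N.

Lemma sed_mul_basis_xor (R : realType) (m n : 'I_16) :
  sed_mul (sed_basis m) (sed_basis n)
  = (-1) ^+ sgn m n *: sed_basis (xor16 m n) :> sedenion R.
Proof.
rewrite (@sed_mul_basisE R m n (xor16 m n) ((-1) ^+ sgn m n)).
  by rewrite rmorphXn rmorphN1.
rewrite val_xor16.
apply: (all2_iota16 (p := fun m n => all (fun c =>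
  sed_coef m n c == (-1) ^+ sgn m n * (c == Nat.lxor m n)%:R) (iota 0 16))).
by vm_compute.
Qed.

(** * Bilinearity, and products of diagonals *)

Section Bilinear.
Variable R : realType.
Implicit Types x y z : sedenion R.

Lemma sed_mulDl x y z : sed_mul (x + y) z = sed_mul x z + sed_mul y z.
Proof.
apply/rowP => c; rewrite !mxE -big_split; apply: eq_bigr => m _.
by rewrite -big_split; apply: eq_bigr => n _; rewrite !mxE mulrDl mulrDr.
Qed.

Lemma sed_mulDr x y z : sed_mul x (y + z) = sed_mul x y + sed_mul x z.
Proof.
apply/rowP => c; rewrite !mxE -big_split; apply: eq_bigr => m _.
by rewrite -big_split; apply: eq_bigr => n _; rewrite !mxE !mulrDr.
Qed.

Lemma sed_mulZl (a : R) x y : sed_mul (a *: x) y = a *: sed_mul x y.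
Proof.
apply/rowP => c; rewrite !mxE mulr_sumr; apply: eq_bigr => m _.
by rewrite mulr_sumr; apply: eq_bigr => n _; rewrite !mxE -mulrA mulrCA.
Qed.

Lemma sed_mulZr (a : R) x y : sed_mul x (a *: y) = a *: sed_mul x y.
Proof.
apply/rowP => c; rewrite !mxE mulr_sumr; apply: eq_bigr => m _.
by rewrite mulr_sumr; apply: eq_bigr => n _; rewrite !mxE [RHS]mulrCA (mulrCA a).
Qed.

(** By linearity [f (f y) = - 2 *: y] extends from the basis to all [y]. Meant for left
    multiplications, whose squares cannot be simplified by associativity. *)
Lemma linear_sqrN2_eq0 (f : sedenion R -> sedenion R) :
  {morph f : x y / x + y} -> (forall a, {morph f : x / a *: x}) ->
  (forall n, f (f (sed_basis n)) = - 2 *: sed_basis n) ->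
  forall y, f y = 0 -> y = 0.
Proof.
move=> fD fZ ff y fy0.
have f0 : f 0 = 0 by rewrite -[X in f X](scale0r 0) fZ scale0r.
have ffE : f (f y) = - 2 *: y.
  rewrite {1}[y]row_sum_delta !(big_morph _ fD f0) [in RHS](row_sum_delta y).
  rewrite scaler_sumr; apply: eq_bigr => n _.
  by rewrite !fZ ff !scalerA mulrC.
move: ffE; rewrite fy0 f0 => /esym/eqP.
by rewrite scaler_eq0 oppr_eq0 pnatr_eq0 /= => /eqP.
Qed.

Lemma zero_divisorZ (a : R) x : a != 0 ->
  zero_divisor (a *: x) <-> zero_divisor x.
Proof.
move=> a0; split=> -[y [y0 xy]]; exists y; split=> //; move: xy;
  rewrite sed_mulZl sed_mulZr.
  by case=> /eqP; rewrite scaler_eq0 (negPf a0) => /eqP ?; [left | right].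
by case=> ->; rewrite scaler0; [left | right].
Qed.

Lemma sed_diagC A B s : sed_diag B A s = (-1) ^+ s *: sed_diag A B s :> sedenion R.
Proof. by rewrite /sed_diag scalerDr scalerA -expr2 sqrr_sign scale1r addrC. Qed.

Lemma sed_mul_diagCl A B s y :
  (sed_mul (sed_diag B A s) y == 0) = (sed_mul (sed_diag A B s) y == 0).
Proof. by rewrite sed_diagC sed_mulZl scaler_eq0 signr_eq0. Qed.

Lemma sed_mul_diagCr C D t x :
  (sed_mul x (sed_diag D C t) == 0) = (sed_mul x (sed_diag C D t) == 0).
Proof. by rewrite sed_diagC sed_mulZr scaler_eq0 signr_eq0. Qed.

Lemma unit_pairE A B s t :
  unit_pair A B s t
  = ((Num.sqrt 2)^-1 * (-1) ^+ s) *: sed_diag A B (s (+) t) :> sedenion R.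
Proof.
rewrite /unit_pair /sed_diag -scalerA; congr (_ *: _).
by rewrite scalerDr scalerA -signr_addb addKb.
Qed.

Lemma unit_pair_scale_neq0 s : (Num.sqrt 2)^-1 * (-1) ^+ s != 0 :> R.
Proof. by rewrite mulf_neq0 ?signr_eq0 // invr_neq0 // sqrtr_eq0 -ltNge. Qed.

Lemma sed_diag_neq0 A B s : A != B -> sed_diag A B s != 0 :> sedenion R.
Proof.
move=> nAB; apply/eqP => /rowP /(_ A) /eqP.
by rewrite !mxE !eqxx (negPf nAB) mulr0 addr0 oner_eq0.
Qed.

(** The terms are grouped by the only pairs that can cancel when [A != B] and [C != D]. *)
Lemma sed_mul_diag A B C D s t :
  sed_mul (sed_diag A B s) (sed_diag C D t)
  = (-1) ^+ sgn A C *: sed_basis (xor16 A C)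
    + (-1) ^+ (s (+) t (+) sgn B D) *: sed_basis (xor16 B D)
    + ((-1) ^+ (t (+) sgn A D) *: sed_basis (xor16 A D)
       + (-1) ^+ (s (+) sgn B C) *: sed_basis (xor16 B C)) :> sedenion R.
Proof.
rewrite /sed_diag !(sed_mulDl, sed_mulDr, sed_mulZl, sed_mulZr).
rewrite !sed_mul_basis_xor !signr_addb !scalerA.
by rewrite [X in _ + X = _]addrC addrACA.
Qed.

(** This is one coordinate of a sum of two signed basis elements; [k] tells whether their indices
    coincide. *)
Lemma add_signs_eq0 (a b k : bool) :
  ((-1) ^+ a + (-1) ^+ b * k%:R == 0 :> R) = k && (a (+) b).
Proof.
case: k; last by rewrite mulr0 addr0 signr_eq0.
rewrite mulr1 addr_eq0; case: a b => [] []; rewrite /= ?expr0 ?expr1 ?opprK ?eqxx //.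
  by rewrite -subr_eq0 -opprD oppr_eq0 (pnatr_eq0 _ 2).
by rewrite -subr_eq0 opprK (pnatr_eq0 _ 2).
Qed.

Lemma sed_mul_diag_eq0 A B C D s t : A != B -> C != D ->
  (sed_mul (sed_diag A B s) (sed_diag C D t) == 0 :> sedenion R)
  = [&& xor16 A C == xor16 B D, sgn A C (+) (s (+) t (+) sgn B D)
      & (t (+) sgn A D) (+) (s (+) sgn B C)].
Proof.
move=> nAB nCD; rewrite sed_mul_diag.
have nACAD : (xor16 A C == xor16 A D) = false.
  by rewrite (inj_eq (@xor16_inj A)) (negPf nCD).
have nACBC : (xor16 A C == xor16 B C) = false.
  by rewrite ![xor16 _ C]xor16C (inj_eq (@xor16_inj C)) (negPf nAB).
have nADBD : (xor16 A D == xor16 B D) = false.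
  by rewrite ![xor16 _ D]xor16C (inj_eq (@xor16_inj D)) (negPf nAB).
apply/eqP/and3P => [/rowP E | [/eqP eqx s1 s2]]; last first.
  rewrite -eqx -(xor16_swap eqx) -!scalerDl.
  have cancel a b : a (+) b -> (-1) ^+ a + (-1) ^+ b = 0 :> R.
    move=> ab; apply/eqP; rewrite -[X in _ + X]mulr1 (add_signs_eq0 _ _ true).
    by rewrite ab.
  by rewrite !cancel // !scale0r addr0.
(* Each of these two coordinates receives only the terms of one group, so it vanishes exactly when
   that group cancels. *)
have /eqP := E (xor16 A C); have /eqP := E (xor16 A D).
rewrite !mxE !eqxx nACAD nACBC [xor16 A D == xor16 A C]eq_sym nACAD nADBD.
rewrite /= !mulr0 !mulr1 !addr0 !add0r !add_signs_eq0.
by move=> /andP[_ ->] /andP[-> ->].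
Qed.

(** The first two hypotheses say that [i_A (i_A i_n)] and [i_B (i_B i_n)] are [- i_n]; the third,
    that [i_B (i_A i_n)] and [i_A (i_B i_n)] are opposite, so the cross terms cancel. *)
Lemma sed_mul_diag_sqr (A B n : 'I_16) (s : bool) :
    sgn A n (+) sgn A (xor16 A n) -> sgn B n (+) sgn B (xor16 B n) ->
    sgn A n (+) sgn B (xor16 A n) (+) (sgn B n (+) sgn A (xor16 B n)) ->
  sed_mul (sed_diag A B s) (sed_mul (sed_diag A B s) (sed_basis n))
  = - 2 *: sed_basis n :> sedenion R.
Proof.
move=> sAA sBB sAB.
rewrite /sed_diag !(sed_mulDl, sed_mulDr, sed_mulZl, sed_mulZr).
rewrite !sed_mul_basis_xor !(sed_mulZr, sed_mulZl) !sed_mul_basis_xor !xor16K.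
rewrite [xor16 B (xor16 A n)]xor16CA !scalerA -!mulrA -!signr_addb addKb sAA sBB.
have -> : sgn A n (+) sgn B (xor16 A n) = ~~ (sgn B n (+) sgn A (xor16 B n)).
  by rewrite -addTb -sAB addbK.
rewrite [X in _ + X = _]addrC addrACA -!scalerDl addbN signrN subrr scale0r addr0.
by rewrite expr1 -opprD.
Qed.

(** * Conjugation, exchanging left and right annihilators *)

Definition sed_conj x : sedenion R := \row_c ((-1) ^+ (c != 0) * x 0 c).

Lemma sed_conjM x y : sed_conj (sed_mul x y) = sed_mul (sed_conj y) (sed_conj x).
Proof.
apply/rowP => c; rewrite !mxE exchange_big mulr_sumr.
apply: eq_bigr => n _; rewrite mulr_sumr; apply: eq_bigr => m _; rewrite !mxE.
(* By bilinearity the claim reduces to this identity between structure constants, checked on all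
   triples of indices. *)
have /eqP coefC : (-1) ^+ (c != 0) * sed_coef m n c
    == (-1) ^+ (n != 0) * (-1) ^+ (m != 0) * sed_coef n m c.
  apply: (all3_iota16 (p := fun m n c => (-1) ^+ (c != 0%N) * sed_coef m n c
    == (-1) ^+ (n != 0%N) * (-1) ^+ (m != 0%N) * sed_coef n m c)).
  by vm_compute.
have := congr1 (intr : int -> R) coefC.
rewrite !rmorphM !rmorphXn !rmorphN1 mulrA /= => ->.
by rewrite [in RHS]mulrACA [RHS]mulrA [_%:~R * (_ * _)]mulrC [x 0 m * _]mulrC.
Qed.

Lemma sed_conj_eq0 x : (sed_conj x == 0) = (x == 0).
Proof.
apply/eqP/eqP => [/rowP x0|->]; apply/rowP => c; rewrite !mxE ?mulr0 //.
by have /eqP := x0 c; rewrite !mxE mulf_eq0 signr_eq0 /= => /eqP.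
Qed.

Lemma sed_conj_diag A B s : imag A -> imag B ->
  sed_conj (sed_diag A B s) = - sed_diag A B s.
Proof.
move=> A0 B0; apply/rowP => c; rewrite !mxE /=.
case: (eqVneq c 0) => [->|_]; last by rewrite mulN1r.
by rewrite ![0 == _]eq_sym (negPf A0) (negPf B0) mulr0 addr0 oppr0 mulr0.
Qed.

(** Conjugating [y x = 0] gives [- x] times the conjugate of [y], so annihilation on either side
    yields annihilation with [x] on the left. *)
Lemma zero_divisor_left x : sed_conj x = - x -> zero_divisor x ->
  exists2 y, y != 0 & sed_mul x y = 0.
Proof.
move=> xN [y [y0 [xy|yx]]]; first by exists y.
exists (sed_conj y); first by rewrite sed_conj_eq0.
have /eqP : sed_conj (sed_mul y x) = 0 by apply/eqP; rewrite yx sed_conj_eq0.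
by rewrite sed_conjM xN -scaleN1r sed_mulZl scaler_eq0 oppr_eq0 oner_eq0 => /eqP.
Qed.

End Bilinear.

(** * Which pairs of indices are Assessors *)

(** One unit is an imaginary Octonion, the other lies beyond [i_8]; the excluded [b = a + 8] is the
    case where [a xor b = 8]. *)
Definition low_high (a b : nat) : bool :=
  [&& 0 < a, a < 8, 8 < b & b != a + 8]%N.

Definition assessor_pair (a b : nat) : bool := low_high a b || low_high b a.

Lemma assessor_pair_imag (A B : 'I_16) :
  assessor_pair A B -> [/\ imag A, imag B & A != B].
Proof.
rewrite /imag -!val_eqE /= => AB.
suff /and3P[] : [&& A != 0%N :> nat, B != 0%N :> nat & A != B :> nat] by [].
move: AB; apply/implyP; apply: (all2_iota16 (p := fun a b => assessor_pair a b ==>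
  [&& a != 0, b != 0 & a != b]%N)).
by vm_compute.
Qed.

(** [i_A (i_A i_n) = - i_n]: left alternativity fails for general Sedenions but holds here on basis
    elements. *)
Lemma sgn_sqr (A n : 'I_16) : imag A -> sgn A n (+) sgn A (xor16 A n).
Proof.
rewrite /imag -val_eqE /= val_xor16; apply/implyP.
apply: (all2_iota16 (p := fun a n => (a != 0%N) ==>
  sgn a n (+) sgn a (Nat.lxor a n))).
by vm_compute.
Qed.

Lemma sgn_anticomm (A B n : 'I_16) : imag A -> imag B -> A != B ->
  ~~ assessor_pair A B ->
  sgn A n (+) sgn B (xor16 A n) (+) (sgn B n (+) sgn A (xor16 B n)).
Proof.
move=> A0 B0 nAB nass; rewrite !val_xor16.
have : [&& A != 0 :> nat, B != 0 :> nat, A != B :> nat 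
    & ~~ assessor_pair A B]%N by apply/and4P.
apply/implyP; apply: (all3_iota16 (p := fun a b n =>
  [&& a != 0, b != 0, a != b & ~~ assessor_pair a b]%N ==>
  (sgn a n (+) sgn b (Nat.lxor a n) (+) (sgn b n (+) sgn a (Nat.lxor b n))))).
by vm_compute.
Qed.

Lemma assessor_pair_coassessor (A B : 'I_16) : assessor_pair A B ->
  exists C D : 'I_16, [/\ imag C, imag D, C != D, xor16 A C = xor16 B D
    & sgn A C (+) sgn B D = sgn A D (+) sgn B C].
Proof.
(* The index equation forces [d], so only [c] is searched. The last condition makes both sign
   conditions ask for the same value of [s (+) t]. *)
pose p a b c := let d := Nat.lxor (Nat.lxor a b) c in
  [&& c != 0, d != 0, c != d, Nat.lxor a c == Nat.lxor b d
    & sgn a c (+) sgn b d == sgn a d (+) sgn b c]%N.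
move=> AB; have : has (p A B) (iota 0 16).
  move: AB; apply/implyP.
  apply: (all2_iota16 (p := fun a b => assessor_pair a b ==> has (p a b) (iota 0 16))).
  by vm_compute.
move=> /hasP[c]; rewrite mem_iota => c16 /and5P[c0 d0 cd /eqP xAC /eqP sg].
pose C := Ordinal c16; pose D := xor16 (xor16 A B) C.
have valD : D = Nat.lxor (Nat.lxor A B) c :> nat by rewrite !val_xor16.
exists C, D; rewrite /imag -!val_eqE /= valD; split=> //.
by apply/val_inj; rewrite /= !val_xor16.
Qed.

Lemma zero_divisor_diag (R : realType) (A B : 'I_16) s :
  imag A -> imag B -> A != B ->
  zero_divisor (sed_diag A B s : sedenion R) -> assessor_pair A B.
Proof.
move=> A0 B0 nAB /zero_divisor_left[|y y0 xy]; first exact: sed_conj_diag.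
apply: contraNT y0 => nass; apply/eqP.
apply: (linear_sqrN2_eq0 (f := sed_mul (sed_diag A B s))) => //.
- exact: sed_mulDr.
- by move=> a z; exact: sed_mulZr.
- by move=> n; apply: sed_mul_diag_sqr; rewrite ?sgn_sqr ?sgn_anticomm.
Qed.

Lemma sed_mul_diag_exists1 (R : realType) (A B C D : 'I_16) :
  A != B -> C != D ->
  (exists s t, sed_mul (sed_diag A B s) (sed_diag C D t) = 0 :> sedenion R) ->
  forall s, exists! t, sed_mul (sed_diag A B s) (sed_diag C D t) = 0 :> sedenion R.
Proof.
move=> nAB nCD [s' [t' /eqP]]; rewrite sed_mul_diag_eq0 // => /and3P[xAC s1 s2] s.
(* The sign conditions see only [s (+) t]; this witness keeps it equal to [s' (+) t']. *)
exists (s' (+) t' (+) s); split.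
  apply/eqP; rewrite sed_mul_diag_eq0 // xAC /=; move: s1 s2.
  by case: s' t' s (sgn A C) (sgn B D) (sgn A D) (sgn B C)
    => [] [] [] [] [] [] [].
move=> t /eqP; rewrite sed_mul_diag_eq0 // xAC /=; move: s1 s2.
by case: s' t' s t (sgn A C) (sgn B D) (sgn A D) (sgn B C)
  => [] [] [] [] [] [] [] [].
Qed.

(** The representatives hidden in [co_assessors] may list either pair in reverse; this only rescales
    a diagonal by a sign, hence the four cases. *)
Lemma co_assessors2E (R : realType) (A B C D : 'I_16) :
  co_assessors R [set A; B]%SET [set C; D]%SET <->
  [/\ [/\ imag A, imag B & A != B], [/\ imag C, imag D & C != D] &
    exists s t, sed_mul (sed_diag A B s) (sed_diag C D t) = 0 :> sedenion R].
Proof.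
split=> [|[AB CD st]]; last by exists A, B, C, D.
move=> [A' [B' [C' [D' [[A0 B0 nAB] [C0 D0 nCD]]]]]].
move=> /esym /(set2_inj nAB) + /esym /(set2_inj nCD) + [s [t /eqP st]].
case=> -[<- <-] [] [<- <-];
  (split; [by split; rewrite // eq_sym | by split; rewrite // eq_sym | ]);
  exists s, t; apply/eqP => //.
- by rewrite sed_mul_diagCr.
- by rewrite sed_mul_diagCl.
- by rewrite sed_mul_diagCl sed_mul_diagCr.
Qed.

Lemma assessor2E (R : realType) (A B : 'I_16) :
  assessor R [set A; B]%SET <-> assessor_pair A B.
Proof.
split=> [[Q coQ]|AB].
  have [_ [_ [C [D [_ [C0 D0 nCD] _ eQ _]]]]] := coQ.
  move: coQ; rewrite eQ => /co_assessors2E[[A0 B0 nAB] _ [s [t st]]].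
  apply: (@zero_divisor_diag R A B s) => //.
  by exists (sed_diag C D t); rewrite sed_diag_neq0 //; split=> //; left.
have [A0 B0 nAB] := assessor_pair_imag AB.
have [C [D [C0 D0 nCD xAC sg]]] := assessor_pair_coassessor AB.
exists [set C; D]%SET; apply/co_assessors2E; split=> //.
(* With [s = false], this [t] makes the signs of the first group opposite; [sg] carries this over to
   the second. *)
exists false, (~~ (sgn A C (+) sgn B D)); apply/eqP.
rewrite sed_mul_diag_eq0 // xAC eqxx /=; move: sg.
by case: (sgn A C) (sgn B D) (sgn A D) (sgn B C) => [] [] [] [].
Qed.

Lemma zero_divisor_unit_pair (R : realType) (A B : 'I_16) s t :
  imag A -> imag B -> A != B ->
  zero_divisor (unit_pair A B s t : sedenion R) <-> assessor_pair A B.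
Proof.
move=> A0 B0 nAB; rewrite unit_pairE; split.
  by move=> /(zero_divisorZ _ (unit_pair_scale_neq0 R s)); exact: zero_divisor_diag.
move=> /(assessor2E R)[Q coQ]; apply/zero_divisorZ.
  exact: unit_pair_scale_neq0.
have [_ [_ [C [D [_ [C0 D0 nCD] _ eQ _]]]]] := coQ.
move: coQ; rewrite eQ => /co_assessors2E[_ _ st].
(* Being Co-Assessors gives a zero product for some diagonal of [A], [B]; this transfers it to the
   one with relative sign [s (+) t]. *)
have [t' [z _]] := sed_mul_diag_exists1 nAB nCD st (s (+) t).
by exists (sed_diag C D t'); rewrite sed_diag_neq0 //; split=> //; left.
Qed.

(** * Enumeration of Assessors by ['I_7 * 'I_6], and of unit zero-divisors with two more signs *)

(* As [lift i] skips [i], the pairs below are exactly those with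
   [0 < A < 8 < B] and [B <> A + 8]. *)
Definition low_ix (p : 'I_7 * 'I_6) : 'I_16 := inord p.1.+1.
Definition high_ix (p : 'I_7 * 'I_6) : 'I_16 := inord (lift p.1 p.2 + 9).

Lemma val_low_ix p : low_ix p = p.1.+1 :> nat.
Proof. by rewrite inordK // ltnS (leq_trans (ltn_ord _)). Qed.

Lemma val_high_ix p : high_ix p = (lift p.1 p.2 + 9)%N :> nat.
Proof. by rewrite inordK // (@ltn_add2r 9 _ 7). Qed.

Lemma low_high_ix p : low_high (low_ix p) (high_ix p).
Proof.
rewrite /low_high val_low_ix val_high_ix /= ltnS ltn_ord /= addnS.
rewrite ltnS leq_addl /= addSn eqSS eqn_add2r eq_sym.
exact: neq_lift.
Qed.

Lemma low_highP (A B : 'I_16) : low_high A B ->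
  exists p, A = low_ix p /\ B = high_ix p.
Proof.
move=> /and4P[A0 A8 B8 nAB].
have iP : (A.-1 < 7)%N by rewrite -ltnS prednK.
have kP : (B - 9 < 7)%N by rewrite ltn_subLR.
(* [B <> A + 8] says that [B - 9] differs from [A - 1], so it is hit by [lift]; the other case is
   contradictory. *)
case: (unliftP (Ordinal iP) (Ordinal kP)) => [j kE | kE].
  exists (Ordinal iP, j); split; apply/val_inj.
    by rewrite /= val_low_ix /= prednK.
  by rewrite /= val_high_ix -kE /= subnK.
move: nAB; rewrite -(subnK B8) (congr1 val kE : (B - 9 = A.-1)%N).
by rewrite addnS -addSn prednK // eqxx.
Qed.

Lemma low_high_ix_inj p q : low_ix p = low_ix q -> high_ix p = high_ix q -> p = q.
Proof.
case: p q => [i j] [i' j'] /(congr1 val) + /(congr1 val).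
rewrite /= !val_low_ix !val_high_ix /= => -[/val_inj <-] /eqP.
by rewrite eqn_add2r => /eqP /(can_inj (bumpK _)) /val_inj ->.
Qed.

Lemma low_ix_neq_high_ix p q : (low_ix p == high_ix q) = false.
Proof.
have /and4P[_ p8 _ _] := low_high_ix p; have /and4P[_ _ q8 _] := low_high_ix q.
by rewrite -val_eqE; apply: ltn_eqF; apply: ltn_trans p8 q8.
Qed.

Definition assessor_of (p : 'I_7 * 'I_6) : {set 'I_16} :=
  [set low_ix p; high_ix p]%SET.

Lemma assessor_of_inj : injective assessor_of.
Proof.
move=> p q /set2_inj; rewrite low_ix_neq_high_ix => /(_ isT).
case=> -[e1 e2]; first exact: low_high_ix_inj.
by move/eqP: e1; rewrite low_ix_neq_high_ix.
Qed.

Definition unit_pair_of (R : realType) (p : 'I_7 * 'I_6 * (bool * bool)) :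
  sedenion R := unit_pair (low_ix p.1) (high_ix p.1) p.2.1 p.2.2.

Lemma unit_pair_of_inj (R : realType) : injective (@unit_pair_of R).
Proof.
move=> [p [s t]] [q [s' t']]; rewrite /unit_pair_of /=.
have /mulfI : (Num.sqrt 2)^-1 != 0 :> R by rewrite invr_neq0 // sqrtr_eq0 -ltNge.
move=> cI /rowP eqpq.
(* The left side is nonzero at both of these coordinates. As low and high indices never meet, this
   forces the indices of [q] to be those of [p], and the signs follow. *)
have := eqpq (low_ix p); have := eqpq (high_ix p).
rewrite !mxE !eqxx ![high_ix _ == low_ix _]eq_sym !low_ix_neq_high_ix /=.
rewrite !mulr0 !mulr1 !addr0 !add0r => /cI + /cI.
case: eqVneq => [eh | _]; last by rewrite mulr0 => /eqP; rewrite signr_eq0.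
case: eqVneq => [el | _]; last by rewrite mulr0 => _ /eqP; rewrite signr_eq0.
by rewrite !mulr1 (low_high_ix_inj el eh) => /signr_inj -> /signr_inj ->.
Qed.

Lemma unit_pairC (R : realType) A B s t :
  unit_pair A B s t = unit_pair B A t s :> sedenion R.
Proof. by rewrite /unit_pair addrC. Qed.

Lemma assessor_pairP (A B : 'I_16) : assessor_pair A B ->
  exists p, (A = low_ix p /\ B = high_ix p) \/ (A = high_ix p /\ B = low_ix p).
Proof.
by case/orP => /low_highP[p [-> ->]]; exists p; [left | right].
Qed.

(** * The sets to be counted, as ranges of the enumerations *)

Lemma assessor_setE (R : realType) :
  [set P : {set 'I_16} | assessor R P] = range assessor_of.
Proof.
apply/seteqP; split=> [P /= aP | _ [p _ <-]]; last first.
  by apply/assessor2E; rewrite /assessor_pair low_high_ix.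
have [_ [A [B [_ [_ [_ _ eP _ _]]]]]] := aP.
move: aP; rewrite eP => /assessor2E /assessor_pairP[p [] [-> ->]]; exists p => //.
exact: finset.setUC.
Qed.

Lemma unit_pair_setE (R : realType) :
  [set x : sedenion R | exists (A B : 'I_16) (s t : bool),
     assessor R [set A; B]%SET /\ x = unit_pair A B s t] = range (@unit_pair_of R).
Proof.
apply/seteqP; split=> [_ [A [B [s [t [/assessor2E /assessor_pairP + ->]]]]] | ].
  (* A pair listed as high then low is reordered by exchanging its two signs. *)
  by case=> p [] [-> ->]; [exists (p, (s, t)) | exists (p, (t, s))];
    rewrite // unit_pairC.
move=> _ [[p [s t]] _ <-]; exists (low_ix p), (high_ix p), s, t; split=> //.
by apply/assessor2E; rewrite /assessor_pair low_high_ix.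
Qed.

Lemma primitive_unit_zero_divisorE (R : realType) :
  [set x : sedenion R | primitive_unit_zero_divisor x] =
  [set x : sedenion R | exists (A B : 'I_16) (s t : bool),
     assessor R [set A; B]%SET /\ x = unit_pair A B s t].
Proof.
apply/seteqP; split=> [x [[A [B [s [t [A0 B0 nAB ->]]]]]] | x].
  by move=> /zero_divisor_unit_pair ass; exists A, B, s, t; split=> //;
    apply/assessor2E/ass.
move=> [A [B [s [t [/assessor2E ass ->]]]]].
have [A0 B0 nAB] := assessor_pair_imag ass.
by split; [exists A, B, s, t | apply/zero_divisor_unit_pair].
Qed.

Theorem mainTheorem1 (R : realType) :
  [/\ [set P : {set 'I_16} | assessor R P] #= `I_42,
      [set x : sedenion R | primitive_unit_zero_divisor x] #= `I_168,
      [set x : sedenion R | primitive_unit_zero_divisor x] =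
        [set x : sedenion R | exists (A B : 'I_16) (s t : bool),
           assessor R [set A; B]%SET /\ x = unit_pair A B s t] &
      forall A B C D : 'I_16,
        assessor R [set A; B]%SET -> assessor R [set C; D]%SET ->
        co_assessors R [set A; B]%SET [set C; D]%SET ->
        forall s : bool, exists! t : bool,
          sed_mul (sed_diag A B s) (sed_diag C D t) = 0 :> sedenion R].
Proof.
split.
- have := inj_range_card assessor_of_inj.
  by rewrite assessor_setE card_prod !card_ord.
- have := inj_range_card (@unit_pair_of_inj R).
  rewrite primitive_unit_zero_divisorE unit_pair_setE.
  by rewrite !card_prod !card_ord !card_bool.
- exact: primitive_unit_zero_divisorE.
- move=> A B C D _ _ /co_assessors2E[[_ _ nAB] [_ _ nCD]].
  exact: sed_mul_diag_exists1.
Qed.
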